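(* Let $d\ge1$, $k\ge d+3$, and let $n=(n_1,\dots,n_d)\in\mathbb N^d$ with $1\le n_1<n_2<\dots<n_d$. The following statements are equivalent: (i) $\mathfrak n_d^k(n)$ is Hausdorff; (ii) $\mathfrak n_d^k(n)\subseteq \mathfrak f_d^k$; (iii) $\mathfrak n_d^k(n)$ is an open, Hausdorff submanifold of $\mathfrak f_d^k$; (iv) $n_j+n_{d+1-j}<k$ for all $1\le j\le d$.
   Context: $\mathbb{RP}^d$ is the space of lines through the origin in $\mathbb R^{d+1}$. The group $\mathrm{PGL}(d):=\mathrm{GL}(d+1,\mathbb R)/\mathbb R^*$ acts component-wise on $A_d^k=(\mathbb{RP}^d)^k$, and $\mathfrak a_d^k=A_d^k/\mathrm{PGL}(d)$ carries the quotient topology; its elements are called shapes. For $p\in A_d^k$ and $I\subseteq\{1,\dots,k\}$, $\operatorname{rk}p_I$ denotes the dimension of the linear span in $\mathbb R^{d+1}$ of the lines $p_i$, $i\in I$. For $I\subseteq\{1,\dots,k\}$ and an integer $j$ with $1\le j<d+1$ and $|I|\ge j$, $p$ fulfills the projective subspace constraint $(I,j)$ if $\operatorname{rk}p_I\le j$; $C(p)$ is the set of all projective subspace constraints fulfilled by $p$. $N_d^k(n)=\{p\in A_d^k: |I|\le n_j\text{ for all }(I,j)\in C(p)\}$, i.e. at most $n_j$ landmarks lie in any $(j-1)$-dimensional projective subspace. This set is $\mathrm{PGL}(d)$-invariant, and $\mathfrak n_d^k(n)\subseteq\mathfrak a_d^k$ is the set of shapes of its elements, with the subspace topology. A configuration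 $p$ is free if $\{g\in\mathrm{PGL}(d):gp=p\}$ is trivial; $\mathfrak f_d^k\subseteq\mathfrak a_d^k$ is the set of shapes of free configurations with the subspace topology. It is a (generally non-Hausdorff) differentiable manifold of dimension $d(k-d-2)$: a second-countable, locally Euclidean T1 space with smooth transition maps. *)

(* Defs.v *)
From HB Require Import structures.
From mathcomp Require Import all_boot all_order all_algebra.
From mathcomp Require Import generic_quotient.
From mathcomp Require Import all_classical all_reals all_analysis.
Set Implicit Arguments.
Unset Strict Implicit.
Unset Printing Implicit Defensive.
Import Order.TTheory GRing.Theory Num.Theory.
Import numFieldNormedType.Exports.
Local Open Scope classical_set_scope.
Local Open Scope quotient_scope.
Local Open Scope ring_scope.

Section ProjectiveSpace.
Context (R : realType) (d : nat).

(* RP^d is the quotient of R^(d+1) \ {0} by proportionality. *)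
Definition nzvec : set 'cV[R]_d.+1 := [set v | v != 0].

Definition same_line : rel nzvec := fun u v =>
  `[< exists2 a : R, a != 0 & \val u = a *: \val v >].

Lemma same_line_refl : reflexive same_line.
Proof. by move=> u; apply/asboolP; exists 1; rewrite ?oner_eq0 ?scale1r. Qed.

Lemma same_line_sym : symmetric same_line.
Proof.
have h u v : same_line u v -> same_line v u.
  move=> /asboolP[a a0 e]; apply/asboolP; exists a^-1; first by rewrite invr_eq0.
  by rewrite e scalerA mulVf // scale1r.
by move=> u v; apply/idP/idP; exact: h.
Qed.

Lemma same_line_trans : transitive same_line.
Proof.
move=> v u w /asboolP[a a0 e] /asboolP[b b0 e']; apply/asboolP.
by exists (a * b); rewrite ?mulf_neq0 // e e' scalerA.
Qed.

Canonical same_line_equiv :=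
  EquivRel same_line same_line_refl same_line_sym same_line_trans.

Definition RP := quotient_topology {eq_quot same_line_equiv}.

Definition line (x : RP) : {vspace 'cV[R]_d.+1} := <[\val (repr x : nzvec)]>%VS.

Definition GL := {A : 'M[R]_d.+1 | A \in unitmx}.

Definition same_scale : rel GL := fun A B =>
  `[< exists2 a : R, a != 0 & \val A = a *: \val B >].

Lemma same_scale_refl : reflexive same_scale.
Proof. by move=> u; apply/asboolP; exists 1; rewrite ?oner_eq0 ?scale1r. Qed.

Lemma same_scale_sym : symmetric same_scale.
Proof.
have h u v : same_scale u v -> same_scale v u.
  move=> /asboolP[a a0 e]; apply/asboolP; exists a^-1; first by rewrite invr_eq0.
  by rewrite e scalerA mulVf // scale1r.
by move=> u v; apply/idP/idP; exact: h.
Qed.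

Lemma same_scale_trans : transitive same_scale.
Proof.
move=> v u w /asboolP[a a0 e] /asboolP[b b0 e']; apply/asboolP.
by exists (a * b); rewrite ?mulf_neq0 // e e' scalerA.
Qed.

Canonical same_scale_equiv :=
  EquivRel same_scale same_scale_refl same_scale_sym same_scale_trans.

Definition PGL := {eq_quot same_scale_equiv}.

Definition GL1 : GL := exist (fun A => A \in unitmx) 1%:M (unitmx1 R d.+1).
Definition PGL1 : PGL := \pi_PGL GL1.

Lemma GL_nzvec (A : GL) (v : nzvec) : (\val A *m \val v) \in nzvec.
Proof.
case: A v => A /= uA [v /= /set_mem v0]; apply/mem_set => /=; apply: contra v0.
by move=> /eqP e; rewrite -(mulKmx uA v) e mulmx0.
Qed.

Definition GL_act (A : GL) (v : nzvec) : nzvec :=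
  exist (fun w => w \in nzvec) _ (GL_nzvec A v).

Definition PGL_act (g : PGL) (x : RP) : RP := \pi_RP (GL_act (repr g) (repr x)).

(* The class of [A *m v] depends only on the classes of [A] and [v]. *)
Lemma PGL_actE (A : GL) (v : nzvec) :
  PGL_act (\pi_PGL A) (\pi_RP v) = \pi_RP (GL_act A v).
Proof.
rewrite /PGL_act; apply/eqmodP/asboolP => /=.
have /asboolP[a a0 ea] : same_scale (repr (\pi_PGL A)) A.
  by apply/eqmodP; rewrite reprK.
have /asboolP[b b0 eb] : same_line (repr (\pi_RP v)) v.
  by apply/(@eqmodP _ same_line_equiv); exact: (@reprK _ RP).
exists (a * b); first by rewrite mulf_neq0.
by rewrite /= ea eb -scalemxAl -scalemxAr scalerA.
Qed.

Lemma PGL_act1 (x : RP) : PGL_act PGL1 x = x.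
Proof.
rewrite -[x]reprK PGL_actE; congr (\pi_RP _); apply: val_inj => /=.
by rewrite mul1mx.
Qed.

Lemma PGL_actV (g : PGL) : exists h : PGL, forall x, PGL_act h (PGL_act g x) = x.
Proof.
have uV : invmx (\val (repr g)) \in unitmx by rewrite unitmx_inv; case: (repr g).
exists (\pi_PGL (exist (fun A => A \in unitmx) _ uV)) => x.
rewrite [PGL_act g x]/PGL_act PGL_actE -[RHS]reprK; congr (\pi_RP _).
by apply: val_inj => /=; rewrite mulKmx //; case: (repr g).
Qed.

Lemma PGL_actM (g h : PGL) :
  exists gh : PGL, forall x, PGL_act gh x = PGL_act g (PGL_act h x).
Proof.
have uM : \val (repr g) *m \val (repr h) \in unitmx.
  by rewrite unitmx_mul; case: (repr g) (repr h) => [? ->] [? ->].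
exists (\pi_PGL (exist (fun A => A \in unitmx) _ uM)) => x.
rewrite -[x in LHS]reprK PGL_actE [PGL_act h x]/PGL_act -[g in RHS]reprK PGL_actE.
by congr (\pi_RP _); apply: val_inj => /=; rewrite mulmxA.
Qed.

End ProjectiveSpace.

Arguments nzvec : clear implicits.

Section Shapes.
Context (R : realType) (d k : nat).

Definition config := prod_topology (fun _ : 'I_k => RP R d).

Definition config_act (g : PGL R d) (p : config) : config :=
  fun i => PGL_act g (p i).

Definition same_shape : rel config := fun p q =>
  `[< exists g : PGL R d, q = config_act g p >].

Lemma same_shape_refl : reflexive same_shape.
Proof.
move=> p; apply/asboolP; exists (PGL1 R d).
by apply/funext => i; rewrite /config_act PGL_act1.
Qed.

Lemma same_shape_sym : symmetric same_shape.
Proof.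
have h p q : same_shape p q -> same_shape q p.
  move=> /asboolP[g ->]; apply/asboolP; have [h hg] := PGL_actV g.
  by exists h; apply/funext => i; rewrite /config_act hg.
by move=> p q; apply/idP/idP; exact: h.
Qed.

Lemma same_shape_trans : transitive same_shape.
Proof.
move=> q p r /asboolP[g ->] /asboolP[h ->]; apply/asboolP.
have [hg E] := PGL_actM h g.
by exists hg; apply/funext => i; rewrite /config_act E.
Qed.

Canonical same_shape_equiv :=
  EquivRel same_shape same_shape_refl same_shape_sym same_shape_trans.

Definition shape_space := quotient_topology {eq_quot same_shape_equiv}.

Definition shape_of (p : config) : shape_space := \pi_shape_space p.

Definition rk (p : config) (I : {set 'I_k}) : nat :=
  \dim (\sum_(i in I) line (p i))%VS.

(* C(p): the pair (I, j) encodes the condition rk p_I <= j. *)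
Definition constraints (p : config) : set ({set 'I_k} * nat) :=
  [set c : {set 'I_k} * nat |
    [/\ (1 <= c.2 < d.+1)%N, (c.2 <= #|c.1|)%N & (rk p c.1 <= c.2)%N]].

(* [n j] stands for n_j; only the values for 1 <= j <= d matter. *)
Definition bounded_configs (n : nat -> nat) : set config :=
  [set p | forall I j, constraints p (I, j) -> (#|I| <= n j)%N].

Definition bounded_shapes (n : nat -> nat) : set shape_space :=
  shape_of @` bounded_configs n.

Definition free_config (p : config) : Prop :=
  forall g : PGL R d, config_act g p = p -> g = PGL1 R d.

Definition free_shapes : set shape_space := shape_of @` [set p | free_config p].

End Shapes.

Arguments bounded_shapes : clear implicits.
Arguments free_shapes : clear implicits.

Section Manifolds.
Context (R : realType) (m : nat).

Fixpoint Cr (r : nat) (U : set 'rV[R]_m) (f : 'rV[R]_m -> 'rV[R]_m) : Prop :=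
  if r is r'.+1 then
    (forall x, U x -> differentiable f x) /\
    (forall v, Cr r' U (fun x => 'D_v f x))
  else forall x, U x -> {for x, continuous f}.

Definition smooth (U : set 'rV[R]_m) (f : 'rV[R]_m -> 'rV[R]_m) : Prop :=
  forall r, Cr r U f.

(* A chart is a domain together with a map that is only relevant there. *)
Record chart (M : Type) := Chart { cdom : set M; cmap : M -> 'rV[R]_m }.

(* homeomorphism from an open subset of M onto an open subset of R^m *)
Definition is_chart (M : topologicalType) (c : chart M) : Prop :=
  [/\ open (cdom c),
      {within cdom c, continuous (cmap c)},
      set_inj (cdom c) (cmap c) &
      forall V : set M, open V -> V `<=` cdom c -> open (cmap c @` V)].

Definition smooth_transition (M : Type) (c c' : chart M) : Prop :=
  exists2 f, smooth (cmap c @` (cdom c `&` cdom c')) f &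
    forall x, cdom c x -> cdom c' x -> f (cmap c x) = cmap c' x.

(* A manifold is not required to be Hausdorff, but only T1. *)
Definition smooth_manifold (M : topologicalType) (A : set (chart M)) : Prop :=
  [/\ @second_countable M, accessible_space M,
      A `<=` @is_chart M, \bigcup_(c in A) cdom c = [set: M] &
      forall c c', A c -> A c' -> smooth_transition c c'].

Definition restrict_chart (M : Type) (U : set M) (c : chart M) : chart U :=
  Chart (set_val @^-1` cdom c) (cmap c \o set_val).

(* [U] is an open subset of M which inherits by restriction of the charts
   whatever structure of smooth m-dimensional manifold M has. *)
Definition open_submanifold (M : topologicalType) (U : set M) : Prop :=
  open U /\ forall A : set (chart M), smooth_manifold A ->
    @smooth_manifold U (@restrict_chart M U @` A).

End Manifolds.

Arguments open_submanifold R m {M} U.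

(* Main.v *)
(* A matrix [M <> 0] with [M p_i] contained in [q_i] for all [i] splits the
   landmarks: those of [p] killed by [M] lie in the kernel, for the others [q_i]
   lies in the range. If both configurations are bounded and [M] has rank [r]
   with [0 < r < d + 1], counting gives [k <= n_r + n_(d+1-r)]. Under (iv) such an
   [M] is therefore invertible. For [M = g - lambda], with [lambda] an eigenvalue
   of [g] fixing [p], this yields freeness. For [M] a limit of normalized lifts of
   transformations [g_m] with [g_m p_m = q_m], [p_m -> p] and [q_m -> q], which
   exists by compactness of the unit sphere, it yields the Hausdorff property.
   Conversely, if [n_j + n_(d+1-j) >= k], put landmarks in general position in two
   complementary subspaces of dimensions [j] and [d + 1 - j]: the transformations
   [diag (1, e)] fix this configuration, and contract to it a perturbation
   by one landmark of different shape. *)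

Require Import Defs.
From mathcomp Require Import all_boot all_order all_algebra.
From mathcomp Require Import generic_quotient zify.
From mathcomp Require Import all_classical all_reals all_analysis.
Import Order.TTheory GRing.Theory Num.Theory.
Import numFieldNormedType.Exports.
Local Open Scope classical_set_scope.
Local Open Scope quotient_scope.
Local Open Scope ring_scope.
Set Implicit Arguments.
Unset Strict Implicit.
Unset Printing Implicit Defensive.

(** * Continuity of matrix operations *)

Section MatrixTopology.
Context (R : realType) (T : topologicalType).
Implicit Types (t : T).

Lemma mx_continuous_at m n (f : T -> 'M[R]_(m, n)) t :
  (forall i j, {for t, continuous (fun s => f s i j)}) -> {for t, continuous f}.
Proof.
move=> fc U [P nP PU].
have : nbhs t [set s | forall i j, P i j (f s i j)].
  apply: (@filter_forall _ _ _ (nbhs t) (nbhs_filter t)) => i.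
  apply: (@filter_forall _ _ _ (nbhs t) (nbhs_filter t)) => j.
  exact: fc (nP i j).
by apply: (@filterS _ _ (nbhs_filter t)) => s; exact: PU.
Qed.

Lemma mxE_continuous_at m n (f : T -> 'M[R]_(m, n)) t i j :
  {for t, continuous f} -> {for t, continuous (fun s => f s i j)}.
Proof.
move=> fc; apply: (@continuous_comp _ _ _ f (fun M => M i j)) => //.
exact: coord_continuous.
Qed.

Lemma mulmx_continuous_at m n k (f : T -> 'M[R]_(m, n)) (g : T -> 'M[R]_(n, k)) t :
  {for t, continuous f} -> {for t, continuous g} ->
  {for t, continuous (fun s => f s *m g s)}.
Proof.
move=> fc gc; apply: mx_continuous_at => i j.
have -> : (fun s => (f s *m g s) i j) = (fun s => \sum_k f s i k * g s k j).
  by apply/funext => s; rewrite mxE.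
apply: (@cvg_big _ _ _ _ _ _ _ _ _ (fun k s => f s i k * g s k j)) => [|l _].
  exact: add_continuous.
by apply: continuousM; exact: mxE_continuous_at.
Qed.

Lemma det_continuous_at n (f : T -> 'M[R]_n) t :
  {for t, continuous f} -> {for t, continuous (fun s => \det (f s))}.
Proof.
move=> fc; apply: cvg_big => [|s _]; first exact: add_continuous.
apply: cvgM; first exact: cvg_cst.
apply: cvg_big => [|i _]; first exact: mul_continuous.
exact: mxE_continuous_at.
Qed.

End MatrixTopology.

(** * Lines, configurations and shapes *)

Section Lines.
Context (R : realType) (d : nat).
Implicit Types (u v : 'cV[R]_d.+1) (x : RP R d).

Let const1_nzvec : (const_mx 1 : 'cV[R]_d.+1) \in nzvec R d.
Proof.
apply/mem_set; apply/eqP => /matrixP /(_ 0 0); rewrite !mxE.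
exact/eqP/oner_neq0.
Qed.

Let ones : nzvec R d := exist (fun w => w \in nzvec R d) _ const1_nzvec.

(* On the zero vector [line_of] takes a junk value. *)
Definition line_of v : RP R d :=
  \pi_(RP R d) (insubd ones v).

Let val_nz v : v != 0 ->
  \val (insubd ones v) = v.
Proof. by move=> v0; rewrite val_insubd mem_set. Qed.

Lemma line_of_val (w : nzvec R d) : line_of (\val w) = \pi_(RP R d) w.
Proof.
by congr (\pi_(RP R d) _); apply/val_inj; rewrite val_nz//; exact: set_mem (valP w).
Qed.

Lemma line_ofP x : exists2 v, v != 0 & x = line_of v.
Proof.
exists (\val (repr x : nzvec R d)); first exact: set_mem (valP (repr x)).
by rewrite line_of_val reprK.
Qed.

Lemma line_of_eq u v : u != 0 -> v != 0 ->
  line_of u = line_of v <-> exists2 a, a != 0 & u = a *: v.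
Proof.
move=> u0 v0; split.
  by move/(@eqmodP _ (same_line_equiv R d))/asboolP; rewrite /= !val_nz.
by move=> uv; apply/(@eqmodP _ (same_line_equiv R d))/asboolP; rewrite /= !val_nz.
Qed.

Lemma line_line_of v : v != 0 -> line (line_of v) = <[v]>%VS.
Proof.
move=> v0; rewrite /line.
set w := repr _; have w0 : \val w != 0 by exact: set_mem (valP w).
have : line_of (\val w) = line_of v by rewrite line_of_val reprK.
move=> /line_of_eq -/(_ w0 v0)[a a0 ->]; apply/eqP; rewrite eqEsubv.
apply/andP; split; apply/vlineP; first by exists a.
by exists a^-1; rewrite scalerA mulVf// scale1r.
Qed.

Lemma PGL_act_line_of (A : GL R d) v : v != 0 ->
  PGL_act (\pi_(PGL R d) A) (line_of v) = line_of (\val A *m v).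
Proof.
move=> v0; rewrite PGL_actE -line_of_val; congr line_of => /=.
by rewrite val_nz.
Qed.

Lemma nbhs_neq0 v : v != 0 -> nbhs v [set w | w != 0].
Proof.
move=> v0; have /existsP[i vi0] : [exists i, v i 0 != 0].
  apply: contraNT v0; rewrite negb_exists => /forallP vi0.
  apply/eqP/colP => i; rewrite mxE; apply/eqP; exact: contraNT (vi0 i).
exists (fun j k => [set y : R | (j == i) ==> (y != 0)]).
  move=> j k; case: eqP => [->|_] /=; last first.
    by apply: (@filterS _ (nbhs (v j k)) _ setT); [move=> y|exact: filterT].
  by rewrite ord1; apply: open_nbhs_nbhs; split => //; exact: open_neq.
by move=> w /= /(_ i 0); rewrite eqxx /=; apply: contra => /eqP ->; rewrite mxE.
Qed.

Lemma line_of_continuous v : v != 0 -> {for v, continuous line_of}.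
Proof.
move=> v0 U; rewrite nbhsE; case=> O [oO Ov] OU.
(* Openness in [RP] unfolds twice: by the quotient topology the preimage in [nzvec] is open, and
   [nzvec] being a subspace, this preimage is the trace of an open [B]. *)
have [B oB BO] : open (\pi_(RP R d) @^-1` O) by [].
have Bv : B v.
  suff : (set_val @^-1` B) (insubd ones v).
    by rewrite /= set_valE val_nz.
  by rewrite BO.
apply: filterS (filterI (nbhs_neq0 v0) (open_nbhs_nbhs (conj oB Bv))) => w [w0 Bw].
apply: OU; change ((\pi_(RP R d) @^-1` O) (insubd ones w)).
by rewrite -BO /= set_valE val_nz.
Qed.

(** The saturation of an open set is a union of its images under nonzero homotheties, hence open. So
    lines close to a given line have lifts close to a given lift. *)
Lemma line_of_open v (U : set 'cV[R]_d.+1) : v != 0 -> nbhs v U ->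
  nbhs (line_of v) (line_of @` (U `&` [set w | w != 0])).
Proof.
move=> v0; rewrite nbhsE; case=> O [oO Ov] OU.
rewrite nbhsE; exists (line_of @` (O `&` [set w | w != 0])); last first.
  by apply: image_subset => w [/OU].
split; last by exists v.
exists (\bigcup_(a in [set a : R | a != 0]) (GRing.scale a @^-1` O)).
  apply: bigcup_open => a _; apply: open_comp => // w _.
  exact: scaler_continuous.
apply/seteqP; split => [w [a a0 /= Oaw]|w [u [Ou u0]] /=].
  have w0 : \val w != 0 by exact: set_mem (valP w).
  have aw0 : a *: \val w != 0 by rewrite scaler_eq0 negb_or a0.
  exists (a *: \val w) => //; rewrite -line_of_val.
  by apply/line_of_eq => //; exists a.
have w0 : \val w != 0 by exact: set_mem (valP w).
rewrite -line_of_val => /line_of_eq -/(_ u0 w0)[a a0 uw].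
by exists a => //=; rewrite set_valE -uw.
Qed.

End Lines.

Arguments line_of {R d} v.

Lemma col_mulmx (F : pzRingType) m n k (A : 'M[F]_(m, n)) (B : 'M[F]_(n, k)) i :
  col i (A *m B) = A *m col i B.
Proof. by rewrite !colE mulmxA. Qed.

Lemma col_continuous (R : realType) m k (i : 'I_k) :
  continuous (@col R m k i).
Proof.
move=> V U [P nP PU].
exists (fun a j => [set y | j = i -> P a 0 y]) => [a j|W WP].
  have [->|/eqP ji] := eqVneq j i; last by apply: filterS filterT => y _ /ji.
  by have := nP a 0; rewrite mxE; apply: filterS => y Py _.
by apply: PU => a j; rewrite mxE ord1; exact: WP.
Qed.

(** * Configurations as matrices of homogeneous coordinates *)

Section Configurations.
Context (R : realType) (d k : nat).
Implicit Types (V W : 'M[R]_(d.+1, k)) (p q : config R d k).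

Definition nonzero_cols V : Prop := forall i, col i V != 0.

(** Column [i] is a lift of landmark [i]. Topology and linear algebra are carried out on these
    matrices rather than on the quotients. *)
Definition config_of V : config R d k := fun i => line_of (col i V).

Lemma config_ofP p : exists2 V, nonzero_cols V & p = config_of V.
Proof.
have /choice[f fP] : forall i, exists v, v != 0 /\ p i = line_of v.
  by move=> i; have [v] := line_ofP (p i); exists v.
have fE i : col i (\matrix_(a, j) f j a 0) = f i.
  by apply/colP => a; rewrite !mxE.
exists (\matrix_(a, j) f j a 0) => [i|]; first by rewrite fE; case: (fP i).
by apply/funext => i; rewrite /config_of fE; case: (fP i).
Qed.

Lemma GL_nonzero_cols (A : GL R d) V : nonzero_cols V ->
  nonzero_cols (\val A *m V).
Proof.
move=> V0 i; have := V0 i; apply: contra => /eqP AVi; apply/eqP.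
by rewrite -(mulKmx (valP A) (col i V)) -col_mulmx AVi mulmx0.
Qed.

Lemma config_act_of (A : GL R d) V : nonzero_cols V ->
  config_act (\pi_(PGL R d) A) (config_of V) = config_of (\val A *m V).
Proof.
move=> V0; apply/funext => i.
by rewrite /config_act /config_of PGL_act_line_of ?col_mulmx.
Qed.

Lemma near_nonzero_cols V : nonzero_cols V -> \forall W \near V, nonzero_cols W.
Proof.
move=> V0.
apply: (@filter_forall _ _ (fun i W => col i W != 0) (nbhs V) (nbhs_filter V)) => i.
exact: (@col_continuous R d.+1 k i V [set w | w != 0] (nbhs_neq0 (V0 i))).
Qed.

Lemma config_of_continuous V : nonzero_cols V -> {for V, continuous config_of}.
Proof.
move=> V0; have FF : Filter (config_of @ V) by apply: fmap_filter; exact: nbhs_filter.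
apply/cvg_sup => i U.
rewrite (@nbhsE (initial_topology _)) => -[_ [[B oB <-] /= BVi] BU].
have nB : nbhs (line_of (col i V)) B by exact: open_nbhs_nbhs.
have := @col_continuous R d.+1 k i V _ (line_of_continuous (V0 i) nB).
by apply: (@filterS _ (nbhs V) (nbhs_filter V)) => W ?; exact: BU.
Qed.

(** Besides being continuous, the projection is open: it is so on each column, and there are
    finitely many columns. *)
Lemma nbhs_config_of V (U : set (config R d k)) : nonzero_cols V ->
  nbhs (config_of V) U <-> \forall W \near V, U (config_of W).
Proof.
move=> V0; split; first exact: config_of_continuous.
move=> [P nP PU].
pose Q i : set (RP R d) :=
  line_of @` ([set c : 'cV[R]_d.+1 | forall a, P a i (c a 0)] `&` [set w | w != 0]).
have nQ i : nbhs (line_of (col i V)) (Q i).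
  apply: line_of_open => //; exists (fun a j => P a i) => [a j|c Pc a].
    by rewrite mxE.
  exact: Pc.
have : nbhs (config_of V) [set p | forall i, Q i (p i)].
  apply: (@filter_forall _ _ (fun i p => Q i (p i)) _ (nbhs_filter _)) => i.
  exact: (@proj_continuous _ (fun=> RP R d) i (config_of V) _ (nQ i)).
apply: (@filterS _ _ (nbhs_filter _)) => p pQ.
(* Each line of [p] has a lift in its prescribed box; together these lifts form a matrix in the
   given neighbourhood of [V]. *)
have /choice[f fP] : forall i, exists c : 'cV[R]_d.+1,
    (forall a, P a i (c a 0)) /\ line_of c = p i.
  by move=> i; have [c [Pc _] cE] := pQ i; exists c.
have fE i : col i (\matrix_(a, j) f j a 0) = f i.
  by apply/colP => a; rewrite !mxE.
suff -> : p = config_of (\matrix_(a, j) f j a 0).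
  by apply: PU => a j; rewrite mxE; have [+ _] := fP j; apply.
by apply/funext => i; rewrite /config_of fE; have [_ <-] := fP i.
Qed.

Lemma config_act_continuous (g : PGL R d) :
  continuous (config_act g : config R d k -> config R d k).
Proof.
move=> p; have [V V0 ->] := config_ofP p.
pose A : GL R d := repr g.
have gA : g = \pi_(PGL R d) A by rewrite reprK.
move=> U; rewrite gA config_act_of// => /(nbhs_config_of _ (GL_nonzero_cols A V0)).
have Ac : {for V, continuous (fun W => \val A *m W)}.
  by apply: mulmx_continuous_at; [exact: cst_continuous|exact: cvg_id].
move=> /Ac /(filterI (near_nonzero_cols V0)) nU; apply/(nbhs_config_of _ V0).
by apply: filterS nU => W [W0 /= UW]; rewrite /= config_act_of.
Qed.

Lemma shape_of_act (g : PGL R d) p : shape_of (config_act g p) = shape_of p.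
Proof.
apply/esym/(@eqmodP _ (same_shape_equiv R d k))/asboolP.
by exists g.
Qed.

Lemma shape_of_eq p q : shape_of p = shape_of q ->
  exists g : PGL R d, q = config_act g p.
Proof. by move/(@eqmodP _ (same_shape_equiv R d k))/asboolP. Qed.

(** The group acts by continuous maps, and the saturation of [U] is the union of the preimages of
    [U] under the group elements. *)
Lemma shape_of_open (U : set (config R d k)) : open U -> open (@shape_of R d k @` U).
Proof.
move=> oU; change (open (@shape_of R d k @^-1` (@shape_of R d k @` U))).
have -> : @shape_of R d k @^-1` (@shape_of R d k @` U) =
    \bigcup_(g in [set: PGL R d]) (config_act g @^-1` U).
  apply/seteqP; split => [p [q Uq /esym/shape_of_eq[g qE]]|p [g _ Ugp]].
    by exists g => //=; rewrite -qE.
  by exists (config_act g p) => //; rewrite shape_of_act.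
apply: bigcup_open => g _; apply: open_comp => // p _.
exact: config_act_continuous.
Qed.

Lemma nbhs_shape_of V (U : set (shape_space R d k)) : nonzero_cols V ->
  nbhs (shape_of (config_of V)) U <->
  \forall W \near V, U (shape_of (config_of W)).
Proof.
move=> V0; split => [nU|/(nbhs_config_of (@shape_of R d k @^-1` U) V0)].
  apply/(nbhs_config_of (@shape_of R d k @^-1` U) V0).
  exact: (@pi_continuous _ _ (config_of V) U nU).
rewrite !nbhsE => -[B [oB BV] BU]; exists (@shape_of R d k @` B).
  by split; [exact: shape_of_open|exists (config_of V)].
by move=> _ [q /BU Uq <-].
Qed.

End Configurations.

Arguments config_of {R d k} V.

(** Stabilizers along an orbit are conjugate: if [B] fixes [A p], then [A^-1 B A] fixes [p]. *)
Lemma free_config_act (R : realType) (d k : nat) (g : PGL R d) (p : config R d k) :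
  free_config p -> free_config (config_act g p).
Proof.
move=> pf h hgp; have [V V0 pV] := config_ofP p; subst p.
move: hgp; rewrite -[g]reprK -[h]reprK; set A : GL R d := repr g.
set B : GL R d := repr h => hgp.
have [uA uB] := (valP A, valP B).
have uAV : invmx (\val A) \in unitmx by rewrite unitmx_inv.
have uC : invmx (\val A) *m \val B *m \val A \in unitmx.
  by rewrite !unitmx_mul uAV uA uB.
pose A' : GL R d := exist (fun A => A \in unitmx) _ uAV.
pose C : GL R d := exist (fun A => A \in unitmx) _ uC.
have /pf/eqmodP/asboolP[c c0 Cc] :
    config_act (\pi_(PGL R d) C) (config_of V) = config_of V.
  have AV0 := GL_nonzero_cols A V0.
  have := congr1 (config_act (\pi_(PGL R d) A')) hgp.
  rewrite !config_act_of//; last exact: GL_nonzero_cols.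
  by rewrite /= mulKmx// !mulmxA.
have BC : \val B = \val A *m (invmx (\val A) *m \val B *m \val A) *m invmx (\val A).
  by rewrite !mulmxA mulmxV// mul1mx mulmxK.
apply/eqmodP/asboolP; exists c => //; rewrite BC [X in _ *m X *m _]Cc /=.
by rewrite -scalemxAr mulmx1 -scalemxAl mulmxV.
Qed.

(** * Ranks *)

(** Bridge from the dimensions that define [rk] to matrix ranks. In the full rank factorization of
    [A], the right factor is surjective on column vectors and the left one is injective. *)
Lemma dim_limg_mulmx (F : fieldType) m n (A : 'M[F]_(m, n)) :
  \dim (limg (linfun (mulmx A : 'cV_n -> 'cV_m))) = \rank A.
Proof.
set r := \rank A.
pose f := linfun (mulmx (col_base A) : 'cV_r -> 'cV_m).
pose g := linfun (mulmx (row_base A) : 'cV_n -> 'cV_r).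
have -> : linfun (mulmx A : 'cV_n -> 'cV_m) = (f \o g)%VF.
  by apply/lfunP => x; rewrite comp_lfunE !lfunE /= mulmxA mulmx_base.
have gT : limg g = fullv.
  apply/eqP; rewrite eqEsubv subvf; apply/subvP => y _.
  have -> : y = g (pinvmx (row_base A) *m y).
    by rewrite lfunE /= mulmxA mulmxVp ?mul1mx ?row_base_free.
  by rewrite memv_img ?memvf.
rewrite limg_comp gT limg_dim_eq; first by rewrite dimvf dim_matrix; exact: muln1.
apply/eqP; rewrite capfv; apply/lker0P => x y; rewrite !lfunE /=.
exact: row_full_inj (col_base_full A) _ _.
Qed.

(** Columns outside [I] are zeroed instead of removed, so the size stays fixed and masking is
    multiplication by a diagonal matrix. *)
Definition mask_cols (F : pzRingType) m k (V : 'M[F]_(m, k)) (I : {set 'I_k}) :=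
  \matrix_(a, i) (V a i *+ (i \in I)).

Lemma mask_colsE (F : pzRingType) m k (V : 'M[F]_(m, k)) I :
  mask_cols V I = V *m diag_mx (\row_i (i \in I)%:R).
Proof. by apply/matrixP => a i; rewrite mul_mx_diag !mxE mulr_natr. Qed.

Section Rank.
Context (R : realType) (d k : nat).
Implicit Types (V W : 'M[R]_(d.+1, k)) (p q : config R d k) (I J : {set 'I_k}).

Lemma rk_config_of V I : nonzero_cols V ->
  rk (config_of V) I = \rank (mask_cols V I).
Proof.
move=> V0; rewrite -dim_limg_mulmx /rk; congr (\dim _).
have -> : (\sum_(i in I) line (config_of V i) = \sum_(i in I) <[col i V]>)%VS.
  by apply: eq_bigr => i _; exact: line_line_of (V0 i).
apply/eqP; rewrite eqEsubv; apply/andP; split.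
  apply/subv_sumP => i iI; rewrite -memvE.
  have -> : col i V = linfun (mulmx (mask_cols V I) : 'cV_k -> 'cV__) (delta_mx i 0).
    by rewrite lfunE /= -colE; apply/colP => a; rewrite !mxE iI.
  by rewrite memv_img ?memvf.
apply/subvP => y /memv_imgP[x _ ->]; rewrite lfunE /=.
have -> : mask_cols V I *m x = \sum_(i in I) x i 0 *: col i V.
  apply/colP => a; rewrite mxE summxE [RHS]big_mkcond /=; apply: eq_bigr => i _.
  by rewrite !mxE; case: (i \in I); rewrite ?mulr0n ?mul0r// mulr1n mulrC.
by apply: memv_sumr => i iI; rewrite memvZ ?memv_line.
Qed.

Lemma rk_mono p I J : I \subset J -> (rk p I <= rk p J)%N.
Proof.
move=> IJ; apply/dimvS/subv_sumP => i iI.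
by rewrite (sumv_sup i) ?(fintype.subsetP IJ).
Qed.

Lemma rk_act (g : PGL R d) p I : rk (config_act g p) I = rk p I.
Proof.
have [V V0 ->] := config_ofP p; rewrite -[g]reprK config_act_of//.
rewrite !rk_config_of//; last exact: GL_nonzero_cols.
rewrite !mask_colsE -mulmxA.
by rewrite (eqmxMfull _ _)// row_full_unit; case: (repr g).
Qed.

(** One-sided inverses of the factors of [A] compress [A] to the identity of size [\rank A]; the
    determinant of the same compression of [B] stays nonzero for [B] near [A]. *)
Lemma near_rank m n (A : 'M[R]_(m, n)) :
  \forall B \near A, (\rank A <= \rank B)%N.
Proof.
pose P := pinvmx (col_base A); pose Q := pinvmx (row_base A).
have PAQ : P *m A *m Q = 1%:M.
  have : P *m (col_base A *m row_base A) *m Q = 1%:M.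
    by rewrite mulmxA mulVpmx ?col_base_full// mul1mx mulmxVp ?row_base_free.
  by rewrite mulmx_base.
have : {for A, continuous (fun B => \det (P *m B *m Q))}.
  apply: det_continuous_at; apply: mulmx_continuous_at; last exact: cst_continuous.
  by apply: mulmx_continuous_at; [exact: cst_continuous|exact: cvg_id].
have : nbhs (\det (P *m A *m Q)) [set x | x != 0].
  apply: open_nbhs_nbhs; split; first exact: open_neq.
  by rewrite /= PAQ det1 oner_neq0.
move=> /[swap] /[apply]; apply: (@filterS _ _ (nbhs_filter _)) => B /= detB.
have /mxrank_unit <- : P *m B *m Q \in unitmx by rewrite unitmxE unitfE.
exact: leq_trans (mxrankM_maxl _ _) (mxrankM_maxr _ _).
Qed.

Lemma near_rk V I : nonzero_cols V ->
  \forall W \near V, (rk (config_of V) I <= rk (config_of W) I)%N.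
Proof.
move=> V0; have := near_rank (mask_cols V I).
have : {for V, continuous (fun W => mask_cols W I)}.
  rewrite (_ : (fun W => _) = fun W => W *m diag_mx (\row_i (i \in I)%:R)).
  by apply: mulmx_continuous_at; [exact: cvg_id|exact: cst_continuous].
  by apply/funext => W; exact: mask_colsE.
move=> /[apply] /(filterI (near_nonzero_cols V0)).
by apply: (@filterS _ _ (nbhs_filter _)) => W [W0 /=]; rewrite !rk_config_of.
Qed.

Lemma rk_kernel V I (M : 'M[R]_d.+1) : nonzero_cols V ->
  (forall i, i \in I -> M *m col i V = 0) ->
  (\rank M + rk (config_of V) I <= d.+1)%N.
Proof.
move=> V0 MV; rewrite rk_config_of//; apply: mulmx0_rank_max.
apply/matrixP => a i; rewrite mask_colsE mulmxA mul_mx_diag !mxE.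
have [iI|_] := boolP (i \in I); rewrite ?mulr0// mulr1.
by have /matrixP/(_ a 0) := MV i iI; rewrite -col_mulmx !mxE.
Qed.

Lemma rk_image V I (M : 'M[R]_d.+1) : nonzero_cols V ->
  (forall i, i \in I -> exists x, col i V = M *m x) ->
  (rk (config_of V) I <= \rank M)%N.
Proof.
move=> V0 VM.
have /choice[f fP] : forall i, exists x, i \in I -> col i V = M *m x.
  by move=> i; have [/VM[x]|_] := boolP (i \in I); [exists x|exists 0].
rewrite rk_config_of//.
suff -> : mask_cols V I = M *m \matrix_(b, i) (f i b 0 *+ (i \in I)).
  exact: mxrankM_maxl.
apply/matrixP => a i; rewrite !mxE.
have [iI|iI] := boolP (i \in I); last first.
  by rewrite big1// => b _; rewrite mxE (negPf iI) mulr0n mulr0.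
have /matrixP/(_ a 0) := fP i iI; rewrite !mxE mulr1n => ->.
by apply: eq_bigr => b _; rewrite !mxE iI mulr1n.
Qed.

(** The rows [L] act as a dual family: stacked and multiplied with the columns in [I], they give a
    diagonal matrix without zeros on the diagonal. *)
Lemma rk_independent V I : nonzero_cols V ->
  (forall i, i \in I -> exists2 L : 'rV[R]_d.+1, L *m col i V != 0 &
     forall j, j \in I -> j != i -> L *m col j V = 0) ->
  (#|I| <= rk (config_of V) I)%N.
Proof.
move=> V0 indep.
have /choice[L LP] (a : 'I_#|I|) : exists L : 'rV[R]_d.+1,
    L *m col (enum_val a) V != 0 /\
    forall j, j \in I -> j != enum_val a -> L *m col j V = 0.
  by have [L] := indep _ (enum_valP a); exists L.
(* [E] extracts the columns in [I], which makes the product square. *)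
pose E : 'M[R]_(k, #|I|) := \matrix_(i, b) (i == enum_val b)%:R.
have LVE : (\matrix_a L a) *m mask_cols V I *m E =
    diag_mx (\row_a (L a *m col (enum_val a) V) 0 0).
  apply/row_matrixP => a; rewrite -mulmxA row_mul rowK.
  apply/rowP => b; rewrite !mxE.
  transitivity ((L a *m col (enum_val b) V) 0 0).
    rewrite mxE; apply: eq_bigr => c _; rewrite !mxE; congr (_ * _).
    rewrite (bigD1 (enum_val b))//= !mxE enum_valP eqxx mulr1 mulr1n big1 ?addr0//.
    by move=> i /negPf ib; rewrite !mxE ib mulr0.
  have [<-|ab] := eqVneq; first by rewrite mulr1n !mxE.
  have [_ ->] := LP a; rewrite ?enum_valP ?mxE//.
  by rewrite (inj_eq enum_val_inj) eq_sym.
have /mxrank_unit : diag_mx (\row_a (L a *m col (enum_val a) V) 0 0) \in unitmx.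
  rewrite unitmxE det_diag unitfE; apply/prodf_neq0 => a _; rewrite mxE.
  have [+ _] := LP a; apply: contra => /eqP La0.
  by apply/eqP/matrixP => x y; rewrite !ord1 La0 mxE.
rewrite -LVE rk_config_of// => {1}<-.
exact: leq_trans (mxrankM_maxl _ _) (mxrankM_maxr _ _).
Qed.

End Rank.

(** * The balanced case *)

Lemma colinear_minors (F : fieldType) m (u w : 'cV[F]_m) : w != 0 ->
  (forall a b, u a 0 * w b 0 = u b 0 * w a 0) -> exists c, u = c *: w.
Proof.
move=> w0 uw; have /existsP[b wb0] : [exists b, w b 0 != 0].
  apply: contraNT w0; rewrite negb_exists => /forallP wb0.
  by apply/eqP/colP => b; rewrite mxE; exact/eqP/negbNE.
exists (u b 0 / w b 0); apply/colP => a.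
by rewrite !mxE mulrAC -uw mulfK.
Qed.

Section Bounded.
Context (R : realType) (d k : nat) (n : nat -> nat).
Hypothesis n1_ge1 : (1 <= n 1%N)%N.
Hypothesis n_incr : forall i j : nat, (1 <= i)%N -> (i < j)%N -> (j <= d)%N ->
  (n i < n j)%N.
Implicit Types (V W : 'M[R]_(d.+1, k)) (p q : config R d k) (I J : {set 'I_k}).

Lemma leq_add_incr i j : (1 <= i)%N -> (i <= j)%N -> (j <= d)%N ->
  (n i + (j - i) <= n j)%N.
Proof.
move=> i1; elim: j => [|j IH]; first by rewrite leqn0 => /eqP ->; rewrite addn0.
rewrite leq_eqVlt => /predU1P[<- _|ij jd]; first by rewrite subnn addn0.
rewrite subSn// addnS; apply: leq_ltn_trans (IH ij (ltnW jd)) _.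
by apply: n_incr => //; exact: leq_trans i1 ij.
Qed.

Lemma leq_incr j : (1 <= j)%N -> (j <= d)%N -> (j <= n j)%N.
Proof.
move=> j1 jd; have := @leq_add_incr 1 j isT j1 jd; apply: leq_trans.
by rewrite -{1}(subnKC j1) leq_add2r.
Qed.

(** For sets with fewer than [j] elements the bound follows from [j <= n j]. *)
Lemma bounded_configsP p : bounded_configs n p <->
  forall I j, (1 <= j)%N -> (j <= d)%N -> (rk p I <= j)%N -> (#|I| <= n j)%N.
Proof.
split=> [pn I j j1 jd pIj|pn I j [/= /andP[j1 jd] _ pIj]]; last exact: pn.
have [jI|/ltnW Ij] := leqP j #|I|; first by apply: pn; split=> //=; rewrite j1.
exact: leq_trans Ij (leq_incr j1 jd).
Qed.

Lemma bounded_configs_act (g : PGL R d) p :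
  bounded_configs n p -> bounded_configs n (config_act g p).
Proof.
move=> /bounded_configsP pn; apply/bounded_configsP => I j j1 jd.
by rewrite rk_act; exact: pn.
Qed.

Lemma bounded_shapes_of p :
  bounded_shapes R d k n (shape_of p) <-> bounded_configs n p.
Proof.
split=> [[q qn /shape_of_eq[g ->]]|pn]; last by exists p.
exact: bounded_configs_act.
Qed.

(** Ranks do not drop nearby, so a rank bound that holds for [W] already holds for [V]. *)
Lemma near_bounded_configs V : nonzero_cols V -> bounded_configs n (config_of V) ->
  \forall W \near V, bounded_configs n (config_of W).
Proof.
move=> V0 /bounded_configsP Vn.
have : \forall W \near V, forall I, (rk (config_of V) I <= rk (config_of W) I)%N.
  apply: (@filter_forall _ _ _ (nbhs V) (nbhs_filter V)) => I.
  exact: near_rk.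
apply: (@filterS _ _ (nbhs_filter V)) => W VW.
apply/bounded_configsP => I j j1 jd WIj; apply: Vn => //.
exact: leq_trans (VW I) WIj.
Qed.

Lemma open_bounded_shapes : open (bounded_shapes R d k n).
Proof.
rewrite openE => _ [p pn <-]; have [V V0 pV] := config_ofP p.
rewrite pV in pn *; apply/nbhs_shape_of => //.
apply: (@filterS _ _ (nbhs_filter V) _ _ _ (near_bounded_configs V0 pn)) => W Wn.
exact/bounded_shapes_of.
Qed.

Section Balanced.
Hypothesis n_lt : forall j : nat, (1 <= j <= d)%N -> (n j + n (d + 1 - j) < k)%N.

(** The factors [c] may vanish, which admits limits of projective transformations among the matrices
    [M]. *)
Lemma bounded_unitmx V W (M : 'M[R]_d.+1) : nonzero_cols V -> nonzero_cols W ->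
  bounded_configs n (config_of V) -> bounded_configs n (config_of W) ->
  M != 0 -> (forall i, exists c, M *m col i V = c *: col i W) -> M \in unitmx.
Proof.
move=> V0 W0 /bounded_configsP Vn /bounded_configsP Wn M0 MVW.
rewrite -row_full_unit /row_full eqn_leq rank_leq_row leqNgt /=.
apply/negP => Md; pose r := \rank M.
have r1 : (1 <= r)%N by rewrite lt0n mxrank_eq0.
pose I : {set 'I_k} := finset (fun i => M *m col i V == 0).
have VI : (#|I| <= n (d + 1 - r))%N.
  have : (r + rk (config_of V) I <= d.+1)%N.
    by apply: rk_kernel => // i; rewrite inE => /eqP.
  by move=> rI; apply: Vn; rewrite -/r in Md *; lia.
have WI : (#|~: I| <= n r)%N.
  apply: Wn => //; apply: rk_image => // i; rewrite !inE => MVi.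
  have [c Mc] := MVW i; exists (c^-1 *: col i V).
  rewrite -scalemxAr Mc scalerA mulVf ?scale1r//.
  by apply: contra MVi => /eqP c0; rewrite Mc c0 scale0r.
have := @n_lt r; rewrite r1 -ltnS Md => /(_ isT).
by have := cardsC I; rewrite card_ord; lia.
Qed.

Lemma bounded_configs_free p : (1 <= d)%N -> bounded_configs n p -> free_config p.
Proof.
have [V V0 ->] := config_ofP p => d1 pn g; rewrite -[g]reprK; set A := repr g.
rewrite config_act_of// => AV.
have /choice[a aP] : forall i, exists a, \val A *m col i V = a *: col i V.
  move=> i; have := congr1 (fun q => q i) AV.
  rewrite /config_of => /line_of_eq -/(_ (GL_nonzero_cols A V0 i) (V0 i))[a _].
  by rewrite col_mulmx; exists a.
have k0 : (0 < k)%N.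
  by apply: leq_ltn_trans (n_lt (j := 1%N) _).
pose i0 := Ordinal k0.
(* This matrix maps each column to a multiple of itself, so it would be invertible if it were
   nonzero; but it kills column [i0]. *)
have /eqP : \val A - (a i0)%:M == 0.
  apply/negPn/negP => M0.
  have uM : \val A - (a i0)%:M \in unitmx.
    apply: (bounded_unitmx V0 V0 pn pn M0) => i; exists (a i - a i0).
    by rewrite mulmxBl aP mul_scalar_mx scalerBl.
  have /eqP[] := V0 i0; rewrite -(mulKmx uM (col i0 V)).
  by rewrite mulmxBl aP mul_scalar_mx subrr mulmx0.
move=> /subr0_eq Aa; apply/eqmodP/asboolP => /=.
exists (a i0); last by rewrite Aa scalemx1.
apply/eqP => a0; have := valP A; rewrite Aa a0 unitmxE det_scalar expr0n.
by rewrite unitr0.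
Qed.

End Balanced.
End Bounded.

(** * Separation of shapes by compactness of the unit sphere *)

Lemma compact_unit_sphere (R : realType) m :
  compact [set x : 'rV[R]_m | `|x| = 1].
Proof.
apply: bounded_closed_compact.
  exists 1; split => // M M1 x /= ->; exact: ltW.
have -> : [set x : 'rV[R]_m | `|x| = 1] = (fun x => `|x|) @^-1` [set 1].
  by [].
apply: closed_comp => [x _|]; first exact: norm_continuous.
exact: closed_eq.
Qed.

Section Hausdorff.
Context (R : realType) (d k : nat).
Implicit Types (V W : 'M[R]_(d.+1, k)).
Local Notation MR := 'rV[R]_(d.+1 * d.+1).

(** The 2 by 2 minors of the pairs formed by [M p_i] and [q_i]; where [q_i] is nonzero, their
    vanishing says that [M p_i] lies in the line of [q_i]. The matrix [M] is coded as a row vector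
    [x] ranging over the compact unit sphere. *)
Definition minor V W (x : MR) i a b : R :=
  (vec_mx x *m V) a i * W b i - (vec_mx x *m V) b i * W a i.

Lemma minor_continuous i a b :
  continuous (fun z : MR * ('M[R]_(d.+1, k) * 'M[R]_(d.+1, k)) =>
    minor z.2.1 z.2.2 z.1 i a b).
Proof.
move=> z.
have vc : {for z, continuous (fun z : MR * ('M[R]_(d.+1, k) * 'M[R]_(d.+1, k)) =>
     vec_mx z.1 *m z.2.1)}.
  apply: mulmx_continuous_at.
    apply: mx_continuous_at => {}a {}b.
    rewrite (_ : (fun _ => _) = fun z : MR * ('M[R]_(d.+1, k) * 'M[R]_(d.+1, k)) =>
       z.1 0 (mxvec_index a b)); last by apply/funext => s; rewrite mxE.
    by apply: mxE_continuous_at; exact: cvg_fst.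
  by apply: continuous_comp; [exact: cvg_snd|exact: cvg_fst].
have wc : {for z, continuous (fun z : MR * ('M[R]_(d.+1, k) * 'M[R]_(d.+1, k)) =>
     z.2.2)}.
  by apply: continuous_comp; [exact: cvg_snd|exact: cvg_snd].
have vE c := @mxE_continuous_at _ _ _ _ _ _ c i vc.
have wE c := @mxE_continuous_at _ _ _ _ _ _ c i wc.
exact: (cvgB (cvgM (vE a) (wE b)) (cvgM (vE b) (wE a))).
Qed.

(** Tube lemma: having a nonzero minor is an open condition on [x], [V] and [W] jointly, and [x]
    ranges over a compact set. This plays the role of extracting a limit of normalized
    transformations. *)
Lemma near_minors V W :
  (forall x : MR, `|x| = 1 -> exists i a b, minor V W x i a b != 0) ->
  exists N1 N2, [/\ nbhs V N1, nbhs W N2 & forall V' W', N1 V' -> N2 W' ->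
   (forall x : MR, `|x| = 1 -> exists i a b, minor V' W' x i a b != 0)].
Proof.
move=> VW; have /compact_near_coveringP := @compact_unit_sphere R (d.+1 * d.+1).
pose P (z : 'M[R]_(d.+1, k) * 'M[R]_(d.+1, k)) (x : MR) :=
  exists i a b, minor z.1 z.2 x i a b != 0.
move=> /(_ _ (nbhs (V, W)) P (nbhs_filter _))[].
  move=> x /VW[i [a [b ne0]]].
  have n0 : nbhs (minor V W x i a b) [set y | y != 0].
    by apply: open_nbhs_nbhs; split => //; exact: open_neq.
  have := @minor_continuous i a b (x, (V, W)) _ n0.
  by apply: (@filterS _ _ (nbhs_filter _)) => -[x' z] /= ?; exists i, a, b.
move=> [N1 N2] /= [nN1 nN2] NP; exists N1, N2; split=> // V' W' N1V' N2W' x x1.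
exact: (NP (V', W') (conj N1V' N2W') x x1).
Qed.

Lemma colinear_of_minors V W (x : MR) : nonzero_cols W ->
  (forall i a b, minor V W x i a b = 0) ->
  forall i, exists c, vec_mx x *m col i V = c *: col i W.
Proof.
move=> W0 m0 i; apply: colinear_minors (W0 i) _ => a b.
by rewrite -col_mulmx; have /subr0_eq := m0 i a b; rewrite !mxE.
Qed.

Lemma minors_of_colinear V W (x : MR) i a b :
  (exists c, vec_mx x *m col i V = c *: col i W) -> minor V W x i a b = 0.
Proof.
move=> [c]; rewrite -col_mulmx => xV.
have E e : (vec_mx x *m V) e i = c * W e i.
  by have /matrixP/(_ e 0) := xV; rewrite !mxE.
by rewrite /minor !E -!mulrA [W b i * _]mulrC subrr.
Qed.

Lemma unit_sphere_scaling (M : 'M[R]_d.+1) : M != 0 ->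
  exists2 a : R, a != 0 & `|a *: mxvec M| = 1.
Proof.
move=> M0; have M0' : `|mxvec M| != 0.
  by rewrite normr_eq0 mxvec_eq0.
exists `|mxvec M|^-1; first by rewrite invr_eq0.
by rewrite normrZ normfV normr_id mulVf.
Qed.

Lemma hausdorff_bounded_shapes (n : nat -> nat) :
  (1 <= n 1%N)%N ->
  (forall i j : nat, (1 <= i)%N -> (i < j)%N -> (j <= d)%N -> (n i < n j)%N) ->
  (forall j : nat, (1 <= j <= d)%N -> (n j + n (d + 1 - j) < k)%N) ->
  hausdorff_space (bounded_shapes R d k n).
Proof.
move=> n1_ge1 n_incr n_lt x y xy.
have [p pn px] : bounded_shapes R d k n (set_val x) by exact: set_valP.
have [q qn qy] : bounded_shapes R d k n (set_val y) by exact: set_valP.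
have [V V0 pV] := config_ofP p; have [W W0 qW] := config_ofP q.
subst p q; apply: val_inj; rewrite -[LHS]/(set_val x) -[RHS]/(set_val y).
(* Either some unit matrix carries [V] to [W], possibly degenerately, and is then invertible; or
   there is none, and this persists near [V] and [W]. *)
have [[z [z1 zVW]]|no] := pselect (exists z : MR, `|z| = 1 /\
    forall i a b, minor V W z i a b = 0).
  have z0 : vec_mx z != 0.
    by rewrite vec_mx_eq0 -normr_eq0 z1 oner_neq0.
  have zVW' := colinear_of_minors W0 zVW.
  have uz := bounded_unitmx n1_ge1 n_incr n_lt V0 W0 pn qn z0 zVW'.
  rewrite -px -qy.
  pose A : GL R d := exist (fun A => A \in unitmx) _ uz.
  suff -> : config_of W = config_act (\pi_(PGL R d) A) (config_of V).
    by rewrite shape_of_act.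
  rewrite config_act_of//; apply/funext => i; apply/esym.
  apply/(line_of_eq (GL_nonzero_cols A V0 i) (W0 i)).
  have [c cE] := zVW' i; exists c; last by rewrite col_mulmx.
  apply/eqP => c0; have := V0 i; rewrite -(mulKmx uz (col i V)) cE c0 scale0r.
  by rewrite mulmx0 eqxx.
have [z z1|N1 [N2 [nN1 nN2 NP]]] := @near_minors V W _.
  apply/not_existsP => zVW; apply: no; exists z; split => // i a b.
  apply/eqP/negPn/negP => ne0; apply: (zVW i); exists a, b; exact: ne0.
(* Shapes with a lift in [N] form a neighbourhood within the bounded shapes. *)
have nbhsS (U : 'M[R]_(d.+1, k)) (s : bounded_shapes R d k n) N :
    nonzero_cols U -> set_val s = shape_of (config_of U) -> nbhs U N ->
    nbhs s (set_val @^-1` [set t | exists U', [/\ nonzero_cols U', N U' &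
      t = shape_of (config_of U')]]).
  move=> U0 sU nN; apply: (@initial_continuous _ _ set_val s).
  rewrite sU; apply/(nbhs_shape_of _ U0).
  apply: (@filterS _ _ (nbhs_filter _)) (filterI (near_nonzero_cols U0) nN).
  by move=> U' [U'0 NU']; exists U'.
(* Two lifts of a common shape [t] are related by some invertible [A]; scaled to the unit sphere,
   [A] has only zero minors, against the choice of [N1] and [N2]. *)
have [t [[V' [V'0 N1V' tV']] [W' [W'0 N2W' tW']]]] :=
  xy _ _ (nbhsS V x N1 V0 (esym px) nN1) (nbhsS W y N2 W0 (esym qy) nN2).
have [g] := shape_of_eq (etrans (esym tV') tW'); rewrite -[g]reprK.
set A : GL R d := repr g; rewrite config_act_of// => W'V'.
have A0 : \val A != 0.
  by apply/eqP => A0; have := valP A; rewrite A0 unitmxE det0 ?unitr0.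
have [a a0 aA] := unit_sphere_scaling A0.
have [i [b [c /eqP[]]]] := NP _ _ N1V' N2W' _ aA.
apply: minors_of_colinear; have := congr1 (fun p => p i) W'V'.
move=> /esym/line_of_eq -/(_ (GL_nonzero_cols A V'0 i) (W'0 i))[e _ AV'].
exists (a * e); rewrite linearZ /= mxvecK -scalemxAl -col_mulmx AV'.
by rewrite scalerA.
Qed.

End Hausdorff.

(** * Open submanifolds *)

Section OpenSubmanifold.
Context (R : realType) (m : nat).

Lemma Cr_sub r (U U' : set 'rV[R]_m) f : U' `<=` U -> Cr r U f -> Cr r U' f.
Proof.
move=> UU'; elim: r f => [|r IH] f /= => [fc x /UU'|[fd fD]]; first exact: fc.
by split=> [x /UU'|v]; [exact: fd|exact: IH].
Qed.

Context (M : topologicalType) (U : set M).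
Hypothesis oU : open U.

Lemma open_set_val (B : set U) : open B -> open (set_val @` B).
Proof.
move=> [C oC <-]; suff -> : set_val @` (set_val @^-1` C : set U) = C `&` U.
  exact: openI.
apply/seteqP; split=> [_ [x Cx <-]|x [Cx Ux]]; first by split=> //; exact: set_valP.
by exists (exist (fun x => x \in U) x (mem_set Ux)).
Qed.

Lemma set_val_continuous : continuous (set_val : U -> M).
Proof. exact: initial_continuous. Qed.

Lemma restrict_is_chart (c : chart R m M) :
  is_chart c -> is_chart (restrict_chart U c).
Proof.
move=> [oc cc ic imc]; split=> /=.
- by apply: open_comp => // x _; exact: set_val_continuous.
- rewrite continuous_open_subspace => [x /= xc|]; last first.
    by apply: open_comp => // x _; exact: set_val_continuous.
  apply: continuous_comp; first exact: set_val_continuous.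
  move: cc; rewrite continuous_open_subspace//; apply.
  by rewrite inE in xc *.
- move=> x y xc yc /= xy; apply: val_inj; apply: ic => //; exact: mem_set.
- move=> V oV Vc; rewrite -(image_comp set_val (cmap c) V).
  apply: imc; first exact: open_set_val.
  by move=> _ [x /Vc ? <-].
Qed.

(** The countable base, the separating open sets and the charts are all traced on [U]; openness of
    [U] keeps the chart images open. The transition maps remain the same on smaller domains. *)
Lemma smooth_manifold_restrict (A : set (chart R m M)) :
  smooth_manifold A -> smooth_manifold (@restrict_chart R m M U @` A).
Proof.
move=> [[B cB bB] accM Ac cover trans]; split.
- exists ((fun C => set_val @^-1` C : set U) @` B).
    exact: card_le_trans (card_image_le _ _) cB.
  split=> [_ [C /(proj1 bB) oC <-]|x N]; first by exists C.
  rewrite nbhsE => -[_ [[C oC <-] Cx] CN].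
  have [D [BD Dx] DC] := proj2 bB _ _ (open_nbhs_nbhs (conj oC Cx)).
  exists (set_val @^-1` D); first by split=> //; exists D.
  by move=> y Dy; apply: CN; exact: DC.
- move=> x y xy; have [C [oC xC yC]] := accM (set_val x) (set_val y) xy.
  exists (set_val @^-1` C); split; first by exists C.
    by rewrite inE in xC *.
  by rewrite !inE in yC *.
- by move=> _ [c /Ac ? <-]; exact: restrict_is_chart.
- apply/seteqP; split=> // x _; have [c cA cx] : (\bigcup_(c in A) cdom c) (set_val x).
    by rewrite cover.
  by exists (restrict_chart U c) => //; exists c.
- move=> _ _ [c cA <-] [c' cA' <-]; have [f fs fE] := trans _ _ cA cA'.
  exists f => [r|x]; last exact: fE.
  apply: Cr_sub (fs r) => _ [x [xc xc'] <-]; by exists (set_val x).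
Qed.

End OpenSubmanifold.

(** * The unbalanced case *)

Section MomentBlocks.
Context (R : realType) (d k j j' a b : nat) (n : nat -> nat).
Hypothesis n1_ge1 : (1 <= n 1%N)%N.
Hypothesis n_incr : forall i j : nat, (1 <= i)%N -> (i < j)%N -> (j <= d)%N ->
  (n i < n j)%N.
Hypothesis j_ge1 : (1 <= j)%N.
Hypothesis j'_ge1 : (1 <= j')%N.
Hypothesis jj' : (j + j' = d.+1)%N.
Hypothesis abk : (a + b = k)%N.
Hypothesis an : (a <= n j)%N.
Hypothesis bn : (b <= n j')%N.
Hypothesis ja : (j < a)%N.

(* For [e = 0], the first [a] columns lie on the moment curve of the first [j]
   coordinates and the others on that of the last [j'] coordinates. *)
Definition blocks (e : R) : 'M[R]_(d.+1, k) := \matrix_(r, i)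
  if (r < j)%N == (i < a)%N then i%:R ^+ (r - (if (i < a)%N then 0 else j))
  else if ((r : nat) == j) && ((i : nat) == 0) then e else 0.

(** First row of the lower block. The parameter [e] enters only here, in column 0, and pushes that
    landmark out of the first subspace. *)
Let rowj : 'I_d.+1 := inord j.

Let rowjE : rowj = j :> nat.
Proof. by rewrite inordK// -jj' -{1}[j]addn0 ltn_add2l. Qed.

Lemma blocks_nonzero e : nonzero_cols (blocks e).
Proof.
move=> i; have [ia|ia] := ltnP i a; apply/eqP => /matrixP.
  by move=> /(_ 0 0)/eqP; rewrite !mxE j_ge1 ia eqxx subn0 expr0 oner_eq0.
move=> /(_ rowj 0)/eqP; rewrite !mxE rowjE ltnn ltnNge ia eqxx subnn expr0.
by rewrite oner_eq0.
Qed.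

(** The linear form with the coefficients of [p] on one block of coordinates, the first one when [s]
    is true. *)
Definition functional (s : bool) (p : {poly R}) : 'rV[R]_d.+1 :=
  \row_r if (r < j)%N == s then p`_(r - (if s then 0 else j)) else 0.

(** Pairing coefficients with powers on the moment curve evaluates [p] at the node [i]. The second
    summand is the entry [e] of column 0, which only forms on the lower block see. *)
Lemma functional_blocks s (p : {poly R}) e i :
  (size p <= if s then j else j')%N ->
  (functional s p *m col i (blocks e)) 0 0 =
    (if (i < a)%N == s then p.[i%:R] else 0) +
    (if ((i : nat) == 0) && ~~ s then p`_0 * e else 0).
Proof.
move=> ps; rewrite mxE.
(* The summand is extended to all naturals so that the sum can be split at [j]. *)
pose F r : R := (if (r < j)%N == s then p`_(r - (if s then 0 else j)) else 0) *
  (if (r < j)%N == (i < a)%N then i%:R ^+ (r - (if (i < a)%N then 0 else j))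
  else if (r == j) && ((i : nat) == 0) then e else 0).
transitivity (\sum_(0 <= r < j + j') F r).
  by rewrite jj' big_mkord; apply: eq_bigr => r _; rewrite !mxE.
rewrite (big_cat_nat (n := j)) ?leq_addr//=.
rewrite -{2}[j]add0n big_addn addKn !big_mkord.
have i0a : (i : nat) == 0 -> (i < a)%N by move=> /eqP ->; exact: leq_ltn_trans ja.
case: s ps @F => ps F.
  rewrite eqb_id andbF addr0 [X in _ + X]big1 ?addr0 => [|r _]; last first.
    by rewrite /F ltnNge leq_addl /= mul0r.
  case: ifPn => ia; last first.
    rewrite big1// => r _; rewrite /F ltn_ord (negPf ia) /=.
    by rewrite (ltn_eqF (ltn_ord r)) mulr0.
  rewrite (horner_coef_wide _ ps); apply: eq_bigr => r _.
  by rewrite /F ltn_ord ia /= subn0.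
rewrite [X in X + _]big1 ?add0r => [|r _]; last by rewrite /F ltn_ord mul0r.
have [ia|ia] := boolP (i < a)%N => /=.
  rewrite andbT add0r -(prednK j'_ge1) big_ord_recl big1 ?addr0 => [|r _].
    rewrite /F ltnn ia add0n subnn (eqxx j) /=.
    by case: ifP; rewrite ?mulr0.
  rewrite /F lift0 (_ : (r.+1 + j == j)%N = false) ?andbF; last first.
    by rewrite gtn_eqF// addSn ltnS leq_addl.
  by rewrite ltnNge leq_addl ia /= mulr0.
rewrite (contraNF i0a ia) addr0 (horner_coef_wide _ ps); apply: eq_bigr => r _.
by rewrite /F ltnNge leq_addl (negPf ia) /= addnK.
Qed.

Definition vanishing (A : {set 'I_k}) : {poly R} :=
  \prod_(i <- enum A) ('X - (i%:R)%:P).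

Lemma size_vanishing A : size (vanishing A) = #|A|.+1.
Proof. by rewrite size_prod_XsubC cardE. Qed.

Lemma vanishing_eq0 A (i : 'I_k) : ((vanishing A).[i%:R] == 0) = (i \in A).
Proof.
rewrite horner_prod prodf_seq_eq0 -[RHS]mem_enum -has_pred1.
apply: eq_has => l /=; rewrite hornerXsubC subr_eq0 eqr_nat.
by rewrite eq_sym; apply/eqP/eqP => [/val_inj|->].
Qed.

Definition side (s : bool) : {set 'I_k} := finset (fun i : 'I_k => (i < a)%N == s).

(** As in Lagrange interpolation, the polynomial vanishing at the other nodes of the same block
    separates [i]; the cardinality bounds keep its degree below the dimension of the block. *)
Lemma rk_blocks_independent (I : {set 'I_k}) :
  (#|I :&: side true| <= j)%N -> (#|I :&: side false| <= j')%N ->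
  (#|I| <= rk (config_of (blocks 0)) I)%N.
Proof.
move=> I1 I2; apply: rk_independent (blocks_nonzero 0) _ => i iI.
pose s := (i < a)%N; pose A := (I :&: side s) :\ i.
have iIs : i \in I :&: side s by rewrite !inE iI eqxx.
have szA : (size (vanishing A) <= if s then j else j')%N.
  rewrite size_vanishing; have := cardsD1 i (I :&: side s).
  rewrite iIs add1n -/A => <-.
  by case: (s).
exists (functional s (vanishing A)) => [|l lI li].
  apply/eqP => /matrixP/(_ 0 0)/eqP; rewrite functional_blocks// eqxx mulr0.
  by rewrite if_same addr0 mxE vanishing_eq0 !inE eqxx.
apply/matrixP => x y; rewrite !ord1 functional_blocks// mulr0 if_same addr0 mxE.
by case: ifPn => // /eqP ls; apply/eqP; rewrite vanishing_eq0 !inE li lI ls eqxx.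
Qed.

Lemma card_side (I : {set 'I_k}) s :
  (#|I :&: side s| <= if s then a else b)%N.
Proof.
have -> : (if s then a else b) = size (iota (if s then 0 else a) (if s then a else b)).
  by rewrite size_iota.
rewrite cardE -(size_map val); apply: uniq_leq_size.
  by rewrite map_inj_uniq ?enum_uniq//; exact: val_inj.
move=> _ /mapP[i + ->]; rewrite mem_enum !inE mem_iota => /andP[_].
by case: s => /eqP /=; have := ltn_ord i; lia.
Qed.

Lemma subset_of_card (A : {set 'I_k}) m : (m <= #|A|)%N ->
  exists2 B : {set 'I_k}, B \subset A & #|B| = m.
Proof.
move=> /card_geqP[s [us sm sA]]; exists (finset (mem s)).
  by apply/fintype.subsetP => x; rewrite inE; exact: sA.
by rewrite cardsE -sm; exact/card_uniqP.
Qed.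

Lemma blocks0_bounded : bounded_configs n (config_of (blocks 0)).
Proof.
apply/(bounded_configsP n1_ge1 n_incr) => I l l1 ld Il.
(* Each half of [I] is cut down to at most the dimension of its block, which leaves an independent
   set of at most [l] landmarks. *)
have [B1 sB1 cB1] := @subset_of_card (I :&: side true) _ (geq_minl _ j).
have [B2 sB2 cB2] := @subset_of_card (I :&: side false) _ (geq_minl _ j').
have sB s (B : {set 'I_k}) : B \subset I :&: side s ->
    B :&: side s = B /\ B :&: side (~~ s) = finset.set0.
  rewrite finset.subsetI => /andP[_ Bs]; split; first exact/finset.setIidPl.
  apply/finset.setP => i; rewrite !inE; apply/negP => /andP[iB].
  by have := fintype.subsetP Bs _ iB; rewrite inE => /eqP ->; case: s {Bs}.
have [B11 B12] := sB _ _ sB1; have [B22 B21] := sB _ _ sB2.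
have B1U : (B1 :|: B2) :&: side true = B1.
  by rewrite finset.setIUl B11 B21 finset.setU0.
have B2U : (B1 :|: B2) :&: side false = B2.
  by rewrite finset.setIUl B12 B22 finset.set0U.
have rkB : (#|B1 :|: B2| <= rk (config_of (blocks 0)) (B1 :|: B2))%N.
  by apply: rk_blocks_independent; rewrite ?B1U ?B2U ?cB1 ?cB2 geq_minr.
have cardI (C : {set 'I_k}) : (#|C| = #|C :&: side true| + #|C :&: side false|)%N.
  rewrite -(cardsID (side true) C); congr (_ + #|pred_of_set _|)%N.
  by apply/finset.setP => i; rewrite !inE andbC; case: (i < a)%N.
have BI : B1 :|: B2 \subset I.
  rewrite finset.subUset (fintype.subset_trans sB1 (finset.subsetIl _ _)).
  exact: fintype.subset_trans sB2 (finset.subsetIl _ _).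
have := leq_trans (leq_trans rkB (rk_mono _ BI)) Il.
rewrite (cardI (B1 :|: B2)) B1U B2U cB1 cB2 (cardI I).
have := card_side I true; have := card_side I false => /=.
have := leq_incr n1_ge1 n_incr l1 ld.
have := @leq_add_incr d n n_incr j l j_ge1.
have := @leq_add_incr d n n_incr j' l j'_ge1.
(* If no half was cut, [I] has at most [l <= n l] elements. If only the first was, it has at most
   [n j + (l - j) <= n l], and symmetrically for the second. Both cannot be cut, since
   [j + j' > l]. *)
lia.
Qed.

Let scaling_mx (e : R) : 'M[R]_d.+1 :=
  diag_mx (\row_(r < d.+1) if (r < j)%N then 1 else e).

Let scaling_unit e : e != 0 -> scaling_mx e \in unitmx.
Proof.
move=> e0; rewrite unitmxE det_diag unitfE; apply/prodf_neq0 => r _.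
by rewrite mxE; case: ifP; rewrite ?oner_neq0.
Qed.

Definition scaling e (e0 : e != 0) : GL R d :=
  exist (fun A => A \in unitmx) _ (scaling_unit e0).

(** Columns of the second block are merely rescaled, those of the first are unchanged except for the
    entry [f] in column 0. *)
Lemma scaling_blocks e (e0 : e != 0) f :
  config_act (\pi_(PGL R d) (scaling e0)) (config_of (blocks f)) =
  config_of (blocks (e * f)).
Proof.
rewrite config_act_of; last exact: blocks_nonzero.
apply/funext => i; apply/line_of_eq.
- exact: GL_nonzero_cols (scaling e0) _ (blocks_nonzero f) i.
- exact: blocks_nonzero.
exists (if (i < a)%N then 1 else e); first by case: ifP; rewrite ?oner_neq0.
apply/colP => r; rewrite /= mul_diag_mx !mxE.
have i0a : (i : nat) == 0 -> (i < a)%N by move=> /eqP ->; exact: leq_ltn_trans ja.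
case: (ltnP r j) => rj; case: (ltnP i a) => ia /=.
- by [].
- by rewrite (ltn_eqF rj)/= !mulr0.
- by case: ifP; rewrite ?mulr0 ?mul1r.
- by [].
Qed.

(** Scaling the lower block by 2 fixes the configuration, as [2 * 0 = 0], but its diagonal entries 1
    and 2 exclude a scalar matrix. *)
Lemma blocks0_not_free : ~ free_config (config_of (blocks 0)).
Proof.
have n20 : 2 != 0 :> R by rewrite pnatr_eq0.
move=> /(_ (\pi_(PGL R d) (scaling n20))).
rewrite scaling_blocks mulr0 => /(_ erefl)/eqmodP/asboolP[c _ /= /matrixP scE].
have := scE 0 0; have := scE rowj rowj; rewrite !mxE !eqxx /= rowjE ltnn j_ge1.
rewrite !mulr1n mulr1 => <- /eqP; rewrite eq_sym -subr_eq0 -[X in _ - X]mulr1n.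
by rewrite -natrB// oner_eq0.
Qed.

(** * Degeneration of the blocks as the parameter tends to 0 *)

Lemma blocks_continuous : continuous blocks.
Proof.
move=> e; apply: mx_continuous_at => r i.
rewrite (_ : (fun _ => _) = if (r < j)%N == (i < a)%N
  then fun=> i%:R ^+ (r - (if (i < a)%N then 0 else j))
  else if ((r : nat) == j) && ((i : nat) == 0) then id else fun=> 0).
  case: ifP => _; first exact: cst_continuous.
  by case: ifP => _; [exact: cvg_id|exact: cst_continuous].
by apply/funext => f; rewrite mxE; case: ifP => // _; case: ifP.
Qed.

(** These [j + 1] landmarks belong to the first block because [j < a]; their rank is an invariant
    that tells the shapes for parameters 0 and 1 apart. *)
Let first_cols : {set 'I_k} := finset (fun i : 'I_k => (i <= j)%N).

Let card_first_cols : #|first_cols| = j.+1.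
Proof.
have jk : (j.+1 <= k)%N by lia.
have winj : injective (widen_ord jk) by move=> x y /(congr1 val) /= xy; exact: val_inj.
rewrite -[RHS]card_ord -(card_imset _ winj).
apply: eq_card => i; rewrite inE; apply/idP/imsetP => [ij|[l _ ->]].
  by exists (Ordinal (ij : i < j.+1)%N) => //; exact: val_inj.
exact: ltn_ord l.
Qed.

Let rk_blocks0 : (rk (config_of (blocks 0)) first_cols <= j)%N.
Proof.
have <- : \rank (pid_mx j : 'M[R]_d.+1) = j by apply: rank_pid_mx; lia.
apply: rk_image (blocks_nonzero 0) _ => i; rewrite inE => ij.
exists (col i (blocks 0)); apply/colP => r.
rewrite mxE [RHS]mxE (bigD1 r)//= big1 => [|l /negPf lr]; last first.
  by rewrite !mxE eq_sym -val_eqE /= in lr *; rewrite lr mul0r.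
rewrite !mxE eqxx addr0 /= (leq_ltn_trans ij ja).
by case: (r < j)%N => /=; rewrite ?mul1r// mul0r; case: ifP.
Qed.

Let rk_blocks1 : (j < rk (config_of (blocks 1)) first_cols)%N.
Proof.
rewrite -card_first_cols; apply: rk_independent (blocks_nonzero 1) _ => i.
rewrite inE => ij.
have firstP l : l \in first_cols -> (l < a)%N.
  by rewrite inE => lj; exact: leq_ltn_trans ja.
have mx11_eq0 (M : 'M[R]_1) : (M == 0) = (M 0 0 == 0).
  apply/eqP/eqP => [->|M0]; first by rewrite mxE.
  by apply/matrixP => x y; rewrite !ord1 M0 mxE.
have size1 : (size (1%R : {poly R}) <= if false then j else j')%N.
  by rewrite size_poly1.
have [i0|i0] := eqVneq (i : nat) 0%N.
  (* This form reads coordinate [j], which among these columns is nonzero only in column 0. *)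
  exists (functional false 1) => [|l lI li].
    rewrite mx11_eq0 functional_blocks// firstP ?inE//= i0 coef1 add0r mulr1.
    exact: oner_neq0.
  apply/eqP; rewrite mx11_eq0 functional_blocks// firstP//= add0r andbT.
  by case: ifPn => // /eqP l0; case/eqP: li; apply: val_inj; rewrite /= l0 i0.
have k0 : (0 < k)%N by lia.
pose z : 'I_k := Ordinal k0; pose A := first_cols :\ z :\ i.
have zi : i != z by rewrite -val_eqE.
have szA : (size (vanishing A) <= if true then j else j')%N.
  rewrite size_vanishing /=; have := cardsD1 i (first_cols :\ z).
  have := cardsD1 z first_cols; rewrite card_first_cols -/A !inE zi ij leq0n.
  by move=> + Ac; rewrite Ac !add1n => -[->].
(* The polynomial vanishes at all nodes of [first_cols] other than 0 and [i]; dropping the node 0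
   keeps its degree at [j - 1]. The subtracted form cancels its value on column 0. *)
exists (functional true (vanishing A) -
    (vanishing A).[0] *: functional false 1) => [|l lI li].
  rewrite mulmxBl -scalemxAl mx11_eq0 mxE [X in _ + X]mxE [X in _ - X]mxE.
  rewrite !functional_blocks// firstP ?inE//= (negPf i0) /= !addr0 mulr0 subr0.
  by rewrite vanishing_eq0 !inE eqxx.
apply/eqP; rewrite mulmxBl -scalemxAl mx11_eq0 mxE [X in _ + X]mxE [X in _ - X]mxE.
rewrite !functional_blocks// (firstP _ lI) /= andbF addr0 andbT add0r coef1 mulr1.
case: ifPn => [/eqP ->|l0]; first by rewrite mulr1 subrr.
rewrite mulr0 subr0 vanishing_eq0 in_setD1 li in_setD1 lI andbT.
by apply: contra l0 => /eqP ->.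
Qed.

(** The shape [s e] equals [s 1] for all nonzero [e] and tends to [s 0], so every neighbourhood of
    [s 0] contains [s 1], although the two differ. *)
Lemma blocks_not_hausdorff : ~ hausdorff_space (bounded_shapes R d k n).
Proof.
pose s e : shape_space R d k := shape_of (config_of (blocks e)).
have sE e : e != 0 -> s e = s 1.
  move=> e0; have := scaling_blocks e0 1; rewrite mulr1 /s => <-.
  exact: shape_of_act.
have near_s U : nbhs (s 0) U -> U (s 1).
  move/(nbhs_shape_of U (blocks_nonzero 0))/blocks_continuous.
  move=> /nbhs_dnbhs /= nU.
  have n0 : (0 : R)^' [set e | e != 0] by exact: withinT (nbhs_filter _).
  have [e [/= Ue e0]] := filter_ex (filterI nU n0).
  by rewrite -(sE e e0).
have b0 : bounded_shapes R d k n (s 0).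
  by exists (config_of (blocks 0)) => //; exact: blocks0_bounded.
have b1 : bounded_shapes R d k n (s 1).
  (* The bounded shapes form an open neighbourhood of [s 0], so they contain [s 1]. *)
  apply: (near_s (bounded_shapes R d k n)); apply: open_nbhs_nbhs; split=> //.
  exact: (open_bounded_shapes R k n1_ge1 n_incr).
pose x : bounded_shapes R d k n :=
  exist (fun t => t \in bounded_shapes R d k n) _ (mem_set b0).
pose y : bounded_shapes R d k n :=
  exist (fun t => t \in bounded_shapes R d k n) _ (mem_set b1).
move=> hausdorff; have xy : x = y.
  apply: hausdorff => U W.
  rewrite nbhsE => -[_ [[C oC <-] Cx] CU] /nbhs_singleton Wy.
  by exists y; split=> //; apply: CU; apply: near_s; exact: open_nbhs_nbhs.
have /shape_of_eq[g b10] : s 0 = s 1 by exact: (congr1 val xy).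
by have := rk_blocks1; rewrite b10 rk_act ltnNge rk_blocks0.
Qed.

End MomentBlocks.

(* By symmetry one of the two blocks has more landmarks than its dimension,
   because there are at least [d + 3] of them. *)
Lemma unbalanced_blocks (d k : nat) (n : nat -> nat) :
  (d + 3 <= k)%N -> (1 <= n 1%N)%N ->
  (forall i j : nat, (1 <= i)%N -> (i < j)%N -> (j <= d)%N -> (n i < n j)%N) ->
  (forall j j' a b, (1 <= j)%N -> (1 <= j')%N -> (j + j' = d.+1)%N ->
     (a + b = k)%N -> (a <= n j)%N -> (b <= n j')%N -> (j < a)%N -> False) ->
  forall j : nat, (1 <= j <= d)%N -> (n j + n (d + 1 - j) < k)%N.
Proof.
move=> k_ge n1 n_incr no j /andP[j1 jd]; rewrite ltnNge; apply/negP => njk.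
have jn := leq_incr n1 n_incr j1 jd.
(* The block of dimension [j] receives [minn (n j) k] landmarks, and at most [n (d + 1 - j)] remain.
   If it receives at most [j], the other block has at least [d + 3 - j] and the roles are
   exchanged. *)
have [nj|nj] := leqP (minn (n j) k) j.
  by apply: (no (d + 1 - j)%N j (k - minn (n j) k)%N (minn (n j) k)); lia.
by apply: (no j (d + 1 - j)%N (minn (n j) k) (k - minn (n j) k)%N); lia.
Qed.

(** * The cycle of implications, passing through the numerical condition *)

Unset Implicit Arguments.
Local Close Scope ring_scope.
Local Close Scope quotient_scope.

Theorem theorem7p1 (R : realType) (d k : nat) (n : nat -> nat)
  (d_ge1 : (1 <= d)%N) (k_ge : (d + 3 <= k)%N)
  (n1_ge1 : (1 <= n 1%N)%N)
  (n_incr : forall i j : nat, (1 <= i)%N -> (i < j)%N -> (j <= d)%N ->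
     (n i < n j)%N) :
  [<-> (* (i) *)
       hausdorff_space (bounded_shapes R d k n);
       (* (ii) *)
       bounded_shapes R d k n `<=` free_shapes R d k;
       (* (iii) *)
       [/\ bounded_shapes R d k n `<=` free_shapes R d k,
           hausdorff_space (bounded_shapes R d k n) &
           open_submanifold R (d * (k - d - 2))
             (set_val @^-1` bounded_shapes R d k n
                : set (free_shapes R d k))];
       (* (iv) *)
       forall j : nat, (1 <= j <= d)%N -> (n j + n (d + 1 - j) < k)%N].
Proof.
have iv_i := @hausdorff_bounded_shapes R d k n n1_ge1 n_incr.
have iv_ii : (forall j : nat, (1 <= j <= d)%N -> (n j + n (d + 1 - j) < k)%N) ->
    bounded_shapes R d k n `<=` free_shapes R d k.
  move=> n_lt _ [p pn <-]; exists p => //.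
  exact: (bounded_configs_free n1_ge1 n_incr n_lt d_ge1 pn).
have i_iv : hausdorff_space (bounded_shapes R d k n) ->
    forall j : nat, (1 <= j <= d)%N -> (n j + n (d + 1 - j) < k)%N.
  move=> T2; apply: unbalanced_blocks => // j j' a b j1 j'1 jj' abk an bn ja.
  exact: (blocks_not_hausdorff n1_ge1 n_incr j1 j'1 jj' abk an bn ja T2).
have ii_iv : bounded_shapes R d k n `<=` free_shapes R d k ->
    forall j : nat, (1 <= j <= d)%N -> (n j + n (d + 1 - j) < k)%N.
  move=> bf; apply: unbalanced_blocks => // j j' a b j1 j'1 jj' abk an bn ja.
  (* A free shape only provides some free representative [p]; freeness is then carried along the
     orbit to the blocks. *)
  have [|p pf /shape_of_eq[g p0]] := bf (shape_of (config_of (blocks d k j a (0%R : R)))).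
    exists (config_of (blocks d k j a (0%R : R))) => //.
    exact: (blocks0_bounded n1_ge1 n_incr j1 j'1 jj' abk an bn ja).
  apply: (@blocks0_not_free R d k j j' a j1 j'1 jj' ja).
  by rewrite p0; exact: free_config_act.
have oU : open (set_val @^-1` bounded_shapes R d k n : set (free_shapes R d k)).
  by exists (bounded_shapes R d k n) => //; exact: open_bounded_shapes.
tfae.
- by move=> /i_iv/iv_ii.
(* The restriction argument applies to every smooth atlas [A] on the free shapes. *)
- move=> /ii_iv n_lt; split; [exact: iv_ii|exact: iv_i|split=> // A].
  exact: smooth_manifold_restrict.
- by move=> [_ /i_iv].
- exact: iv_i.
Qed.
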